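(* For any $0<\delta\le 1/2$, $0<\epsilon\le 1$ and integer $\Delta\ge 3$, there exists a randomised algorithm that, given the number $n$ of nodes and access to a preference oracle for a bicoloured graph $\mathcal{G}$ without isolated nodes and with maximum degree at most $\Delta$, makes at most $25000\,\epsilon^{-2}(\Delta-1)^{3+4\Delta/\epsilon}\ln\delta^{-1}$ queries to the oracle and outputs, with probability at least $1-\delta$, an estimate $\hat m$ such that $\bigl|\hat m-|M|\bigr|\le\epsilon|M|$, where $M$ is a stable matching in $\mathcal{G}$.
   Context: A bicoloured graph is a simple undirected bipartite graph $\mathcal{G}=(R\cup B,E)$ with red nodes $R$ and blue nodes $B$ (every edge joins a red and a blue node); each node has a linear preference order on its neighbours. A matching is a set of edges no two sharing a node. An edge $\{u,v\}\in E\setminus M$ is unstable relative to a matching $M$ if (i) $u$ is unmatched or prefers $v$ to its partner in $M$, and (ii) $v$ is unmatched or prefers $u$ to its partner in $M$; $M$ is stable if there are no unstable edges. A preference oracle, queried with a node, returns the node's colour and its list of adjacent nodes in order of preference. The algorithm may sample nodes uniformly at random. *)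

(* Defs.v *)
From HB Require Import structures.
From mathcomp Require Import all_boot all_order all_algebra.
From mathcomp Require Import reals exp.
Set Implicit Arguments. Unset Strict Implicit. Unset Printing Implicit Defensive.
Import Order.TTheory GRing.Theory Num.Theory.
Local Open Scope ring_scope.

(* A bicoloured graph on the node set 'I_n, given through its preference
   oracle: [colour v] (true = red, false = blue) and [pref v], the list of
   neighbours of v in decreasing order of preference (most preferred first). *)
Record bigraph (n : nat) := BiGraph {
  colour : 'I_n -> bool;
  pref : 'I_n -> seq 'I_n }.

Section Graphs.
Variable n : nat.
Implicit Types (G : bigraph n) (u v w : 'I_n).

Definition adj G u v : bool := v \in pref G u.

Definition bicoloured G : Prop :=
  (forall v, uniq (pref G v)) /\
  (forall u v, adj G u v = adj G v u) /\
  (forall u v, adj G u v -> colour G u != colour G v).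

Definition no_isolated G : Prop := forall v, pref G v != [::].

Definition max_degree_le G (D : nat) : Prop := forall v, (size (pref G v) <= D)%N.

Definition prefers G u v w : bool := (index v (pref G u) < index w (pref G u))%N.

Definition is_edge G (e : {set 'I_n}) : Prop := exists u v, adj G u v /\ e = [set u; v].

Definition matching G (M : {set {set 'I_n}}) : Prop :=
  (forall e, e \in M -> is_edge G e) /\
  (forall e f, e \in M -> f \in M -> e != f -> [disjoint e & f]).

(* u is unmatched in M, or prefers v to its partner in M *)
Definition willing G (M : {set {set 'I_n}}) u v : bool :=
  [forall w, ([set u; w] \in M) ==> prefers G u v w].

Definition unstable_edge G (M : {set {set 'I_n}}) u v : bool :=
  [&& adj G u v, [set u; v] \notin M, willing G M u v & willing G M v u].

Definition stable_matching G (M : {set {set 'I_n}}) : Prop :=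
  matching G M /\ forall u v, ~~ unstable_edge G M u v.
End Graphs.

(* Randomised query algorithms, as finite decision trees.  The algorithm is
   polymorphic in the (abstract, equality-decidable) type V of nodes, so that it
   can only handle nodes obtained by uniform sampling or from oracle answers. *)
Inductive alg (R : Type) (V : Type) : Type :=
  | Ret of R
  | Coin of (bool -> alg R V)
  | Sample of (V -> alg R V)
  | Query of V & (bool -> seq V -> alg R V).

Arguments Ret {R V}. Arguments Coin {R V}. Arguments Sample {R V}. Arguments Query {R V}.

Section Semantics.
Variables (R : realType) (n : nat) (G : bigraph n).

Fixpoint success_prob (P : R -> bool) (a : alg R 'I_n) : R :=
  match a with
  | Ret r => (P r)%:R
  | Coin k => (success_prob P (k true) + success_prob P (k false)) / 2
  | Sample k => n%:R^-1 * \sum_(v < n) success_prob P (k v)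
  | Query v k => success_prob P (k (colour G v) (pref G v))
  end.

Fixpoint num_queries (a : alg R 'I_n) : nat :=
  match a with
  | Ret _ => 0
  | Coin k => maxn (num_queries (k true)) (num_queries (k false))
  | Sample k => \max_(v < n) num_queries (k v)
  | Query v k => (num_queries (k (colour G v) (pref G v))).+1
  end.
End Semantics.

(* Main.v *)
Require Import Defs.
From HB Require Import structures.
From mathcomp Require Import all_boot all_order all_algebra.
From mathcomp Require Import reals sequences exp.
From mathcomp Require Import zify ring lra.
Set Implicit Arguments. Unset Strict Implicit. Unset Printing Implicit Defensive.
Import Order.TTheory GRing.Theory Num.Theory.

(* Run the parallel Gale-Shapley algorithm, red nodes proposing, for k rounds.
   Let A_k be the set of red nodes that have not exhausted their list, W_k the
   set of blue nodes that currently hold a proposal and R_k the set of red nodes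
   refused in round k + 1. Then #|A_k| = #|W_k| + #|R_k|, where A decreases and W
   increases, so R decreases; as each blue node refuses at most Delta proposals,
   (k + 1) #|R_k| <= Delta #|M| for the limit M, which is stable with
   #|M| = #|A_oo| = #|W_oo|. Hence #|M| <= #|A_k| <= (1 + Delta / (k + 1)) #|M|.
   Membership in A_k is decided by a recursion with branching Delta + 1, costing
   at most 2 (Delta + 1)^k <= 2 (Delta - 1)^(2 k) queries. With k = 2 Delta / eps,
   it remains to estimate #|A_k| >= n / (2 Delta) by sampling
   180 Delta eps^-2 ln delta^-1 nodes, using a Chernoff bound. *)

(** * Parallel Gale-Shapley dynamics *)

Section GaleShapley.
Local Open Scope nat_scope.
Variables (n : nat) (G : bigraph n).
Hypothesis G_bic : bicoloured G.
Implicit Types (t : nat) (r b u v : 'I_n) (M : {set {set 'I_n}}).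

(** The state of the run is one counter per node: the position in its list at which it proposes, so
    that an unrefused proposal is repeated in the next round. Colours are not consulted, since all
    rivals of [r] for [b] have the colour of [r]: the runs with red and with blue proposers do not
    interact. The test is [rejected t' r] written out. *)
Fixpoint rejections t r : nat :=
  if t is t'.+1 then
    let i := rejections t' r in
    i + ((if onth (pref G r) i is Some b then
           has (fun r' => onth (pref G r') (rejections t' r') == Some b)
             (take (index r (pref G b)) (pref G b))
          else false) : bool)
  else 0.

Definition proposes t r b := onth (pref G r) (rejections t r) == Some b.

Definition rejected t r : bool :=
  if onth (pref G r) (rejections t r) is Some b then
    has (fun r' => proposes t r' b) (take (index r (pref G b)) (pref G b))
  else false.

Definition active t : {set 'I_n} :=
  [set r | colour G r & rejections t r < size (pref G r)].
Definition courted t : {set 'I_n} :=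
  [set b | ~~ colour G b & [exists r, proposes t r b]].
Definition losers t : {set 'I_n} := [set r | colour G r & rejected t r].

Lemma rejectionsS t r : rejections t.+1 r = rejections t r + rejected t r.
Proof. by []. Qed.

Lemma rejections_mono t t' r : t <= t' -> rejections t r <= rejections t' r.
Proof.
elim: t' => [|t' IH]; first by rewrite leqn0 => /eqP ->.
rewrite leq_eqVlt => /predU1P[-> //|/IH le_r].
by rewrite rejectionsS (leq_trans le_r) ?leq_addr.
Qed.

Lemma proposesE t r b :
  proposes t r b = (b \in pref G r) && (index b (pref G r) == rejections t r).
Proof.
have [prefU _] := G_bic; rewrite /proposes.
apply/eqP/andP => [ob|[bP /eqP <-]]; last first.
  by rewrite onthE (nth_map b) ?index_mem // nth_index.
have lt_i : rejections t r < size (pref G r) by rewrite -onthTE ob.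
by rewrite -(@onth_nth _ b _ _ _ ob) mem_nth // index_uniq.
Qed.

Lemma adj_sym u v : (u \in pref G v) = (v \in pref G u).
Proof. by have [_ [/(_ v u) ? _]] := G_bic. Qed.

Lemma proposes_adj t r b : proposes t r b -> b \in pref G r.
Proof. by rewrite proposesE => /andP[]. Qed.

Lemma proposes_fun t r b b' : proposes t r b -> proposes t r b' -> b = b'.
Proof. by move=> /eqP e /eqP; rewrite e => -[]. Qed.

Lemma active_proposes t r : rejections t r < size (pref G r) ->
  exists b, proposes t r b.
Proof.
by rewrite -onthTE /proposes; case: onth => // b _; exists b.
Qed.

Lemma proposes_active t r b : proposes t r b -> rejections t r < size (pref G r).
Proof. by move=> /eqP e; rewrite -onthTE e. Qed.

Lemma rejectedP t r b : proposes t r b ->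
  reflect (exists2 r', proposes t r' b & prefers G b r' r) (rejected t r).
Proof.
move=> rb; rewrite /rejected (eqP rb).
apply: (iffP hasP) => [[r' /index_ltn lt_r rb']|[r' rb' lt_r]]; exists r' => //.
by rewrite in_take // adj_sym (proposes_adj rb').
Qed.

Lemma rejected_active t r : rejected t r -> rejections t r < size (pref G r).
Proof. by rewrite /rejected -onthTE; case: onth. Qed.

Lemma rejections_le t r : rejections t r <= size (pref G r).
Proof.
elim: t => // t IH; rewrite rejectionsS.
by case E: (rejected t r); rewrite ?addn0 ?addn1 ?rejected_active.
Qed.

Lemma best_proposal t r b : proposes t r b ->
  exists r', [/\ proposes t r' b, index r' (pref G b) <= index r (pref G b)
               & ~~ rejected t r'].
Proof.
move=> rb; case: (@arg_minnP _ r (fun r' => proposes t r' b)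
  (fun r' => index r' (pref G b)) rb) => r' rb' min_r'.
exists r'; split => //; first exact: min_r'.
by apply/negP => /(rejectedP rb')[r'' /min_r']; rewrite /prefers; lia.
Qed.

(** The best current proposer is not refused and hence proposes to [b] again, so the best offer to
    [b] never gets worse. *)
Lemma proposal_step t r b : proposes t r b ->
  exists2 r', proposes t.+1 r' b & index r' (pref G b) <= index r (pref G b).
Proof.
move=> /best_proposal[r' [rb' le_r' nrej]]; exists r' => //.
by move: rb'; rewrite !proposesE rejectionsS (negbTE nrej) addn0.
Qed.

(** In the round of the refusal a better rival proposes to [b]; from then on [proposal_step] keeps
    an offer at least as good. *)
Lemma lost_proposal t r b :
  b \in pref G r -> index b (pref G r) < rejections t r ->
  exists2 r', proposes t r' b & prefers G b r' r.
Proof.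
move=> rb; elim: t => // t IH; rewrite rejectionsS => lt_b.
suff [r' /proposal_step[r'' ? le_r''] lt_r'] :
    exists2 r', proposes t r' b & prefers G b r' r.
  by exists r'' => //; apply: leq_ltn_trans lt_r'.
(* Either the refusal by [b] happened earlier, or it happens in round [t], where [b] is the current
   target of [r]. *)
have [/IH //|ge_b] := ltnP (index b (pref G r)) (rejections t r).
case rej: (rejected t r) lt_b; last by lia.
move=> lt_b; have prb : proposes t r b by rewrite proposesE rb; lia.
exact/(rejectedP prb).
Qed.

Lemma adj_colour u v : v \in pref G u -> colour G v = ~~ colour G u.
Proof.
by have [_ [_ /[apply]]] := G_bic; case: (colour G u); case: (colour G v).
Qed.

Lemma proposal_courted t r b :
  colour G r -> proposes t r b -> b \in courted t.
Proof.
move=> red rb; rewrite inE (adj_colour (proposes_adj rb)) red /=.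
by apply/existsP; exists r.
Qed.

Lemma courted_mono t t' : t <= t' -> courted t \subset courted t'.
Proof.
elim: t' => [|t' IH]; first by rewrite leqn0 => /eqP ->.
rewrite leq_eqVlt => /predU1P[-> //|/IH sub_t]; apply: subset_trans sub_t _.
apply/subsetP => b; rewrite !inE => /andP[-> /existsP[r /proposal_step[r' rb' _]]].
by apply/existsP; exists r'.
Qed.

Lemma active_antimono t t' : t <= t' -> active t' \subset active t.
Proof.
move=> le_t; apply/subsetP => r; rewrite !inE => /andP[->].
exact/leq_ltn_trans/rejections_mono.
Qed.

Lemma best_unique t r r' b : proposes t r b -> proposes t r' b ->
  ~~ rejected t r -> ~~ rejected t r' -> r = r'.
Proof.
move=> rb rb' nrej nrej'; have rP : r \in pref G b.
  by rewrite adj_sym (proposes_adj rb).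
apply: (index_inj r rP); first by rewrite adj_sym (proposes_adj rb').
apply/eqP; rewrite eqn_leq; apply/andP; split; rewrite leqNgt.
  by apply: contra nrej => lt_r; apply/(rejectedP rb); exists r'.
by apply: contra nrej' => lt_r; apply/(rejectedP rb'); exists r.
Qed.

(** Sending each active red node that is not refused to its target is a bijection onto the courted
    nodes: injective by [best_unique], onto by [best_proposal]. *)
Lemma card_active t : #|active t| = #|courted t| + #|losers t|.
Proof.
have sub_la : losers t \subset active t.
  by apply/subsetP => r; rewrite !inE => /andP[-> /rejected_active].
rewrite addnC -(cardsID (losers t)) (setIidPr sub_la); congr addn.
pose tgt r := odflt r (onth (pref G r) (rejections t r)).
have tgtE r b : proposes t r b -> tgt r = b by rewrite /tgt => /eqP ->.
have tgtP r : r \in active t :\: losers t ->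
    [/\ colour G r, proposes t r (tgt r) & ~~ rejected t r].
  rewrite !inE => /andP[+ /andP[red act]]; rewrite red /= => nrej.
  by have [b rb] := active_proposes act; rewrite (tgtE _ _ rb).
rewrite -(@card_in_imset _ _ tgt) => [|r r' /tgtP[_ rb nrej] /tgtP[_ rb' nrej'] e].
  apply: eq_card => b; apply/imsetP/idP => [[r /tgtP[red rb _]] ->|].
    exact: proposal_courted rb.
  rewrite inE => /andP[blue /existsP[r /best_proposal[r' [rb' _ nrej]]]].
  exists r'; last by rewrite (tgtE _ _ rb').
  rewrite !inE (negbTE nrej) andbF (proposes_active rb') andbT.
  by rewrite (adj_colour (_ : r' \in pref G b)) // adj_sym (proposes_adj rb').
by apply: best_unique rb _ nrej nrej'; rewrite e.
Qed.

(** By [card_active] the number of losers is a decreasing quantity minus an increasing one. Only the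
    cardinality is compared, as a node may be refused late in the run without having been refused
    before. *)
Lemma losers_antimono t t' : t <= t' -> #|losers t'| <= #|losers t|.
Proof.
move=> le_t; have := subset_leq_card (active_antimono le_t).
by rewrite !card_active; have := subset_leq_card (courted_mono le_t); lia.
Qed.

Lemma sum_rejections t :
  \sum_(r | colour G r) rejections t r = \sum_(i < t) #|losers i|.
Proof.
elim: t => [|t IH]; first by rewrite big_ord0 big1.
rewrite (eq_bigr _ (fun r _ => rejectionsS t r)) big_split big_ord_recr -IH /=.
congr addn; rewrite -sum1_card big_mkcond [RHS]big_mkcond /=.
by apply: eq_bigr => r _; rewrite inE; case: colour => //; case: rejected.
Qed.

(** * Bounding the refusals through the maximum degree *)

Variable D : nat.
Hypothesis G_deg : max_degree_le G D.

Lemma card_neighbours (S : {set 'I_n}) :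
  \sum_r #|[set s in S | s \in pref G r]| <= D * #|S|.
Proof.
under eq_bigr => r _ do rewrite -sum1_card big_mkcond.
rewrite exchange_big mulnC -sum_nat_const [leqRHS]big_mkcond /=.
apply: leq_sum => s _; case: ifP => sS; last first.
  by rewrite big1 // => r _; rewrite inE sS.
apply: leq_trans (G_deg s); apply: leq_trans (card_size _).
rewrite -sum1_card [leqRHS]big_mkcond leq_sum // => r _.
by rewrite inE sS adj_sym.
Qed.

Lemma card_dominated (X S : {set 'I_n}) :
  (forall x, x \in X -> exists2 s, s \in S & s \in pref G x) ->
  #|X| <= D * #|S|.
Proof.
move=> domX; apply: leq_trans (card_neighbours S).
rewrite -sum1_card [leqLHS]big_mkcond leq_sum // => x _; case: ifP => // xX.
by have [s sS sx] := domX x xX; apply/card_gt0P; exists s; rewrite inE sS.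
Qed.

(** The nodes that have refused [r] are distinct neighbours of [r], and each is courted at time [t]
    by [lost_proposal]; it remains to count the edges at courted nodes. *)
Lemma sum_rejections_le t :
  \sum_(r | colour G r) rejections t r <= D * #|courted t|.
Proof.
apply: leq_trans (card_neighbours _); rewrite big_mkcond leq_sum // => r _.
case: ifP => // red; have [prefU _] := G_bic.
rewrite -(size_takel (rejections_le t r)) -(card_uniqP (take_uniq _ (prefU r))).
apply/subset_leq_card/subsetP => b b_in; have rb := mem_take b_in.
have [r' rb' _] := lost_proposal rb (index_ltn b_in).
rewrite inE rb andbT; apply: (proposal_courted _ rb').
have br' : r' \in pref G b by rewrite adj_sym (proposes_adj rb').
by rewrite (adj_colour br') (adj_colour rb) negbK.
Qed.

(** By monotonicity each of the rounds 0 to [k] contributes at least [#|losers k|] to the total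
    number of refusals. *)
Lemma losers_le k t : k < t -> k.+1 * #|losers k| <= D * #|courted t|.
Proof.
move=> lt_k; apply: leq_trans (leq_trans (sum_rejections_le k.+1) _); last first.
  by rewrite leq_mul2l (subset_leq_card (courted_mono lt_k)) orbT.
rewrite sum_rejections -[k.+1 in leqLHS]card_ord -sum_nat_const.
by apply: leq_sum => i _; apply: losers_antimono; rewrite -ltnS.
Qed.

Lemma losers_eq0 t : D * n < t -> losers t = set0.
Proof.
move=> lt_t; apply/eqP; rewrite -cards_eq0 -leqn0 leqNgt; apply/negP => pos.
have := leq_trans (losers_le (leqnn t.+1)) (leq_mul (leqnn D) (max_card _)).
by rewrite card_ord; nia.
Qed.

(** All current proposals of red nodes, which may share blue nodes while somebody is still refused.
    The default of [odflt] is never reached, since an active node has a target. *)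
Definition acceptances t : {set {set 'I_n}} :=
  [set [set r; odflt r (onth (pref G r) (rejections t r))] | r in active t].

Lemma acceptancesP t e :
  reflect (exists r b, [/\ colour G r, proposes t r b & e = [set r; b]])
          (e \in acceptances t).
Proof.
apply: (iffP imsetP) => [[r]|[r [b [red rb ->]]]].
  rewrite inE => /andP[red /active_proposes[b rb]] ->.
  by exists r, b; rewrite (eqP rb).
by exists r; rewrite ?(eqP rb) // inE red (proposes_active rb).
Qed.

(** Edges are unordered pairs; the colours recover which end is which. *)
Lemma set2_inj_colour u v u' v' : colour G u -> ~~ colour G v ->
  colour G u' -> ~~ colour G v' -> [set u; v] = [set u'; v'] -> u = u' /\ v = v'.
Proof.
move=> cu cv cu' cv' /setP e.
have /esym := e v; have /esym := e u; rewrite !inE !eqxx orbT /=.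
case/orP=> [/eqP<-|/eqP euv]; last by rewrite -euv cu in cv'.
by case/orP=> [/eqP euv|/eqP<-]; first by rewrite euv cu in cv.
Qed.

Lemma acceptancesE t r b : colour G r -> ~~ colour G b ->
  ([set r; b] \in acceptances t) = proposes t r b.
Proof.
move=> red blue; apply/acceptancesP/idP => [[r' [b' [red' rb']]]|rb]; last first.
  by exists r, b.
have blue' : ~~ colour G b' by rewrite (adj_colour (proposes_adj rb')) red'.
by case/set2_inj_colour=> // -> ->.
Qed.

Lemma card_acceptances t : #|acceptances t| = #|active t|.
Proof.
apply: card_in_imset => r r'; rewrite !inE => /andP[red /active_proposes[b rb]].
move=> /andP[red' /active_proposes[b' rb']]; rewrite (eqP rb) (eqP rb') /=.
by case/set2_inj_colour; rewrite ?(adj_colour (proposes_adj rb)) ?red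
  ?(adj_colour (proposes_adj rb')) ?red'.
Qed.

(** * Stability and size of the matching once nobody is refused *)

Section Stable.
Variable t : nat.
Hypothesis no_loser : losers t = set0.

Lemma not_rejected r : colour G r -> ~~ rejected t r.
Proof. by move=> red; have /setP/(_ r) := no_loser; rewrite !inE red /= => ->. Qed.

(** Compare the position of [b] with the current position of [r]: if [b] comes earlier, it refused
    [r] and now has a better partner; if later, [r] has a better partner; if they agree, the edge is
    matched. *)
Lemma acceptances_stable_red r b : colour G r -> ~~ colour G b ->
  ~~ unstable_edge G (acceptances t) r b.
Proof.
move=> red blue; rewrite /unstable_edge acceptancesE //.
apply/and4P => -[rb nrb /forallP will_r /forallP will_b].
have [lt_b|gt_b|eq_b] := ltngtP (index b (pref G r)) (rejections t r).
- have [r' rb' pref_r'] := lost_proposal rb lt_b.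
  have red' : colour G r'.
    by rewrite (adj_colour (_ : r' \in pref G b)) // adj_sym (proposes_adj rb').
  have := will_b r'; rewrite setUC acceptancesE // rb' /prefers.
  by move: pref_r'; rewrite /prefers; lia.
- have [|b' rb'] := @active_proposes t r.
    by apply: ltn_trans gt_b _; rewrite index_mem.
  have := will_r b'; rewrite acceptancesE ?(adj_colour (proposes_adj rb')) ?red //.
  rewrite rb' /prefers; move: rb'; rewrite proposesE => /andP[_ /eqP ->].
  by lia.
- by rewrite proposesE eq_b eqxx andbT -/(adj G r b) rb in nrb.
Qed.

Lemma acceptances_stable : stable_matching G (acceptances t).
Proof.
split=> [|u v]; last first.
  have [|nuv] := boolP (adj G u v); last by rewrite /unstable_edge (negbTE nuv).
  move=> /adj_colour cv; case cu: (colour G u) cv => cv.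
    by apply: acceptances_stable_red; rewrite ?cv.
  have := @acceptances_stable_red v u; rewrite cv cu => /(_ isT isT).
  by rewrite /unstable_edge setUC [willing _ _ v u && _]andbC /adj adj_sym.
split=> [e /acceptancesP[r [b [_ rb ->]]]|].
  by exists r, b; split => //; apply: proposes_adj rb.
move=> e f /acceptancesP[r [b [red rb ->]]] /acceptancesP[r' [b' [red' rb' ->]]].
have blue : ~~ colour G b by rewrite (adj_colour (proposes_adj rb)) red.
have blue' : ~~ colour G b' by rewrite (adj_colour (proposes_adj rb')) red'.
apply: contraR => /pred0Pn[x /= /andP[]]; rewrite !inE.
(* A shared red node has one target; a red end cannot be a blue end; a shared blue node has one
   unrefused proposer. *)
case/orP=> /eqP ->{x} /orP[] /eqP e1.
- by rewrite -e1 in rb' *; rewrite (proposes_fun rb rb').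
- by rewrite -e1 red in blue'.
- by rewrite -e1 (negbTE blue) in red'.
- rewrite -e1 in rb' *.
  by rewrite (best_unique rb rb' (not_rejected red) (not_rejected red')).
Qed.

Hypothesis G_noiso : no_isolated G.

(** Every red node has a courted neighbour, its first choice. Every blue node has an active
    neighbour: its favourite, if active, and otherwise a proposer it preferred to that favourite.
    Each side thus has at most [D * #|active t|] nodes. *)
Lemma card_nodes_le : n <= 2 * D * #|active t|.
Proof.
have cardA : #|courted t| = #|active t|.
  by rewrite card_active no_loser cards0 addn0.
rewrite -{1}[n]card_ord -(cardsC [set r | colour G r]) -mulnA mul2n -addnn.
apply: leq_add; first rewrite -cardA; apply: card_dominated => x; rewrite !inE.
  move=> red; case E: (pref G x) (G_noiso x) => [|b s] // _.
  exists b; last by rewrite inE eqxx.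
  apply: (subsetP (courted_mono (leq0n t))); apply: (proposal_courted red).
  by rewrite proposesE E inE eqxx /= eqxx.
case E: (pref G x) (G_noiso x) => [|r s] // _ blue.
have rx : r \in pref G x by rewrite E inE eqxx.
have red : colour G r by rewrite (adj_colour rx).
have [act|exh] := ltnP (rejections t r) (size (pref G r)).
  by exists r; rewrite -?E // inE red.
have xr : x \in pref G r by rewrite adj_sym.
have [|r' rb' _] := @lost_proposal t r x xr.
  by rewrite (leq_trans _ exh) ?index_mem.
exists r'; last by rewrite -E adj_sym (proposes_adj rb').
rewrite inE (proposes_active rb') andbT.
by rewrite (adj_colour (_ : r' \in pref G x)) // adj_sym (proposes_adj rb').
Qed.
End Stable.

Theorem truncated_gale_shapley k : no_isolated G ->
  exists M, [/\ stable_matching G M, #|M| <= #|active k|,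
    k.+1 * (#|active k| - #|M|) <= D * #|M| & n <= 2 * D * #|M|].
Proof.
(* This time is later than [k] and late enough for [losers_eq0]. *)
move=> G_noiso; pose t := k + (D * n).+1.
have no_loser : losers t = set0 by apply: losers_eq0; rewrite leq_addl.
have lt_k : k < t by rewrite /t addnS ltnS leq_addr.
have cardM : #|acceptances t| = #|courted t|.
  by rewrite card_acceptances card_active no_loser cards0 addn0.
exists (acceptances t); split.
- exact: acceptances_stable.
- by rewrite card_acceptances subset_leq_card ?active_antimono // ltnW.
- apply: leq_trans (leq_trans (losers_le lt_k) _); last by rewrite cardM.
  rewrite leq_mul2l /= leq_subLR card_active cardM leq_add2r.
  exact/subset_leq_card/courted_mono/ltnW.
- by rewrite card_acceptances; apply: card_nodes_le.
Qed.
End GaleShapley.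

(** * The local query algorithm *)

Section Algorithm.
Local Open Scope nat_scope.
Variables (R : realType) (V : eqType).

(** Decision trees carry no sequencing operator, so subroutines are written in continuation-passing
    style. *)
Fixpoint ask_any (f : V -> (bool -> alg R V) -> alg R V) (s : seq V)
    (K : bool -> alg R V) : alg R V :=
  if s is x :: s' then f x (fun b => if b then K true else ask_any f s' K)
  else K false.

(** The continuation also receives the list of [r], which saves the caller a further query. *)
Fixpoint ask_rejections (t : nat) (r : V) (K : seq V -> nat -> alg R V) :
    alg R V :=
  if t is t'.+1 then
    ask_rejections t' r (fun p i =>
      if onth p i is Some b then
        Query b (fun _ q =>
          ask_any (fun r' K' =>
              ask_rejections t' r' (fun p' i' => K' (onth p' i' == Some b)))
            (take (index r q) q) (fun rej => K p (i + rej)))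
      else K p i)
  else Query r (fun _ p => K p 0).

Definition ask_active (t : nat) (v : V) (K : bool -> alg R V) : alg R V :=
  Query v (fun red _ =>
    if red then ask_rejections t v (fun p i => K (i < size p)) else K false).

Fixpoint sample_active (t s c : nat) (K : nat -> alg R V) : alg R V :=
  if s is s'.+1 then
    Sample (fun v => ask_active t v (fun b => sample_active t s' (c + b) K))
  else K c.
End Algorithm.

(** * Correctness and query cost of the subroutines *)

Section Simulation.
Local Open Scope nat_scope.
Variables (R : realType) (n : nat) (G : bigraph n) (D : nat).
Hypothesis G_deg : max_degree_le G D.
Hypothesis D_gt0 : 0 < D.
Implicit Types a : alg R 'I_n.

(** Lets a deterministic subroutine be replaced by its answer inside any continuation, at a price of
    [q] queries. *)
Definition reduces (q : nat) a a' : Prop :=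
  (forall P, success_prob G P a = success_prob G P a') /\
  num_queries G a <= q + num_queries G a'.

Lemma reduces_refl a : reduces 0 a a.
Proof. by []. Qed.

Lemma reduces_trans q q' a a' a'' :
  reduces q a a' -> reduces q' a' a'' -> reduces (q + q') a a''.
Proof.
move=> [p1 n1] [p2 n2]; split=> [P|]; first by rewrite p1.
by rewrite -addnA (leq_trans n1) ?leq_add2l.
Qed.

Lemma reduces_query q v k a :
  reduces q (k (colour G v) (pref G v)) a -> reduces q.+1 (Query v k) a.
Proof. by move=> [p1 n1]; split=> //; rewrite addSn ltnS. Qed.

Lemma reduces_widen q q' a a' : q <= q' -> reduces q a a' -> reduces q' a a'.
Proof.
by move=> le_q [? n1]; split=> //; rewrite (leq_trans n1) ?leq_add2r.
Qed.

Lemma ask_any_reduces q f (B : pred 'I_n) s (K : bool -> alg R 'I_n) :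
  (forall x K', reduces q (f x K') (K' (B x))) ->
  reduces (size s * q) (ask_any f s K) (K (has B s)).
Proof.
move=> fB; elim: s => [|x s IH] /=; first exact: reduces_refl.
rewrite mulSn; apply: reduces_trans (fB _ _) _.
by case: (B x) => //=; apply: reduces_widen (leq0n _) (reduces_refl _).
Qed.

Fixpoint cost t : nat := if t is t'.+1 then (cost t' * D.+1).+1 else 1.

(** Strictness makes the induction work when [D] is positive, and it leaves room for the colour
    query of [ask_active]. *)
Lemma cost_le t : cost t < 2 * D.+1 ^ t.
Proof.
elim: t => // t IH; have := leq_mul IH (leqnn D.+1).
by rewrite expnSr mulnA /=; lia.
Qed.

Lemma ask_rejections_reduces t r (K : seq 'I_n -> nat -> alg R 'I_n) :
  reduces (cost t) (ask_rejections t r K) (K (pref G r) (rejections G t r)).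
Proof.
elim: t r K => [|t IH] r K /=.
  by apply: reduces_query; apply: reduces_refl.
rewrite mulnS -addnS; apply: reduces_trans (IH _ _) _.
case: (onth _ _) => [b|]; last first.
  by rewrite addn0; apply: reduces_widen (leq0n _) (reduces_refl _).
apply: reduces_query.
set s := take _ _; have le_s : size s * cost t <= cost t * D.
  rewrite mulnC leq_mul2l (leq_trans _ (G_deg b)) ?orbT //.
  by rewrite size_take; case: ifP => // /ltnW.
apply: reduces_widen le_s _.
by apply: ask_any_reduces => x K'; apply: IH.
Qed.

Lemma ask_active_reduces t v (K : bool -> alg R 'I_n) :
  reduces (2 * D.+1 ^ t) (ask_active t v K) (K (v \in active G t)).
Proof.
apply: reduces_widen (cost_le t) _; apply: reduces_query; rewrite inE.
case: colour => /=; first exact: ask_rejections_reduces.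
exact: reduces_widen (leq0n _) (reduces_refl _).
Qed.

Lemma num_queries_sample_active t s c (K : nat -> alg R 'I_n) q :
  (forall c', num_queries G (K c') <= q) ->
  num_queries G (sample_active t s c K) <= s * (2 * D.+1 ^ t) + q.
Proof.
move=> Kq; elim: s c => [|s IH] c; first exact: Kq.
apply/bigmax_leqP => v _.
have [_ le_v] := ask_active_reduces t v (fun b => sample_active t s (c + b) K).
apply: leq_trans le_v _.
by rewrite (mulSn s) -addnA leq_add2l.
Qed.

(** * Exponential moments of the sampled count *)

Local Open Scope ring_scope.

Lemma success_sample_active (P : pred R) t s c (K : nat -> alg R 'I_n) :
  success_prob G P (sample_active t s.+1 c K) =
  n%:R^-1 * \sum_(v < n)
    success_prob G P (sample_active t s (c + (v \in active G t))%N K).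
Proof.
congr (_ * _); apply: eq_bigr => v _.
have [E _] := ask_active_reduces t v (fun b => sample_active t s (c + b) K).
exact: E.
Qed.

(** The expectation of x to the power of a Bernoulli variable of mean [p]; at [x = expR l] it is the
    moment generating function at [l]. *)
Definition mgf (p x : R) : R := 1 + p * (x - 1).

Lemma mean_pow_indicator (A : {set 'I_n}) (x : R) : (0 < n)%N ->
  n%:R^-1 * \sum_(v < n) x ^+ (v \in A) = mgf (#|A|%:R / n%:R) x.
Proof.
move=> n0; have n0' : n%:R != 0 :> R by rewrite pnatr_eq0 -lt0n.
rewrite (eq_bigr (fun v => 1 + (x - 1) * (v \in A)%:R)) => [|v _]; last first.
  by case: (v \in A); rewrite ?expr1 ?expr0 /=; ring.
rewrite big_split /= -mulr_sumr sumr_const card_ord -natr_sum.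
rewrite -big_mkcond sum1_card /mgf.
by field.
Qed.

(* Exponential moment method: a failing count c lies above the threshold
   where a x^c >= 1, or below the one where b y^c >= 1, and each draw multiplies
   the expectation of x^c by mgf p x. *)
Lemma success_sample_active_ge (P : pred R) t (K : nat -> alg R 'I_n)
    (a b x y : R) (p := #|active G t|%:R / n%:R) :
  (0 < n)%N -> 0 <= a -> 0 <= b -> 0 <= x -> 0 <= y ->
  (forall c, 1 - a * x ^+ c - b * y ^+ c <= success_prob G P (K c)) ->
  forall s c, 1 - a * x ^+ c * mgf p x ^+ s - b * y ^+ c * mgf p y ^+ s
    <= success_prob G P (sample_active t s c K).
Proof.
move=> n0 a0 b0 x0 y0 KP; elim=> [|s IH] c; first by rewrite !expr0 !mulr1.
have n0' : n%:R != 0 :> R by rewrite pnatr_eq0 -lt0n.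
rewrite success_sample_active.
apply: le_trans (_ : n%:R^-1 * \sum_(v < n)
   (1 - a * x ^+ (c + (v \in active G t)) * mgf p x ^+ s
      - b * y ^+ (c + (v \in active G t)) * mgf p y ^+ s) <= _); last first.
  by rewrite ler_wpM2l ?invr_ge0 // ler_sum.
rewrite !sumrB sumr_const card_ord.
have E (a' z : R) : \sum_(v < n) a' * z ^+ (c + (v \in active G t)) * mgf p z ^+ s
    = n%:R * (a' * z ^+ c * mgf p z ^+ s.+1).
  rewrite exprS -[X in X * _ ^+ s](@mean_pow_indicator _ z n0).
  rewrite (_ : n%:R * _ = a' * z ^+ c * mgf p z ^+ s *
      \sum_(v < n) z ^+ (v \in active G t)).
    by rewrite mulr_sumr; apply: eq_bigr => v _; rewrite exprD; ring.
  by field.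
rewrite !E [leRHS](_ : _ = 1 - a * x ^+ c * mgf p x ^+ s.+1
  - b * y ^+ c * mgf p y ^+ s.+1) //.
by field.
Qed.
End Simulation.

Local Open Scope ring_scope.

(** * A two-sided Chernoff bound *)

Section Concentration.
Variable R : realType.
Implicit Types p l g : R.

Lemma expR_le_inv1B l : l < 1 -> expR l <= (1 - l)^-1.
Proof.
move=> l1; rewrite -[l in expR l]opprK expRN.
by rewrite lef_pV2 ?posrE ?expR_gt0 ?subr_gt0 ?expR_ge1Dx.
Qed.

(** Apply 1 + z <= exp z, then bound [expR l - 1] by a rational function, so that the choice of [l]
    becomes a matter of polynomial inequalities. *)
Lemma mgf_expR_le p l s : 0 <= p <= 1 -> l < 1 ->
  mgf p (expR l) ^+ s <= expR (s%:R * p * (l / (1 - l))).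
Proof.
move=> /andP[p0 p1] l1; rewrite -mulrA expRM_natl.
have mgf0 : 0 <= mgf p (expR l).
  by have := expR_gt0 l; rewrite /mgf; nra.
apply: lerXn2r; rewrite ?nnegrE ?expR_ge0 //.
apply: le_trans (expR_ge1Dx _); rewrite /mgf lerD2l ler_wpM2l //.
have -> : l / (1 - l) = (1 - l)^-1 - 1.
  by field; rewrite subr_eq0 gt_eqF.
by rewrite lerD2r expR_le_inv1B.
Qed.

(** Up to second order the exponent with parameter l is l^2 - l g, minimal at l = g / 2 with value -
    g^2 / 4. Higher-order terms weaken 1/4 to 1/5, which is attained here at g = 1/3. *)
Lemma exponent_upper g : 0 < g <= 1 / 3 ->
  g / 2 / (1 - g / 2) - g / 2 * (1 + g) <= - (g ^+ 2 / 5).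
Proof.
move=> /andP[g0 g1].
have -> : g / 2 / (1 - g / 2) = g / (2 - g) by field; lra.
suff : g / (2 - g) <= g / 2 + 3 / 10 * g ^+ 2 by nra.
by rewrite ler_pdivrMr; [nra|lra].
Qed.

Lemma exponent_lower g : 0 < g <= 1 / 3 ->
  - (g / 2) / (1 - - (g / 2)) + g / 2 * (1 - g) <= - (g ^+ 2 / 5).
Proof.
move=> /andP[g0 g1].
have -> : - (g / 2) / (1 - - (g / 2)) = - (g / (2 + g)) by field; lra.
suff : g / 2 - 3 / 10 * g ^+ 2 <= g / (2 + g) by nra.
by rewrite ler_pdivlMr; [nra|lra].
Qed.

Lemma success_estimate n (G : bigraph n) D (P : pred R) t s (h : nat -> R) g
    (p := #|active G t|%:R / n%:R) :
  max_degree_le G D -> (0 < D)%N -> (0 < n)%N -> 0 < g <= 1 / 3 ->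
  (forall c : nat, `|c%:R - s%:R * p| <= g * (s%:R * p) -> P (h c)) ->
  1 - 2 * expR (- (s%:R * p * (g ^+ 2 / 5)))
    <= success_prob G P (sample_active t s 0 (fun c => Ret (h c))).
Proof.
move=> G_deg D0 n0 g_bnd hP; have /andP[g0 g1] := g_bnd.
have p_bnd : 0 <= p <= 1.
  rewrite /p divr_ge0 // ler_pdivrMr ?ltr0n // mul1r ler_nat.
  by rewrite -[leqRHS]card_ord max_card.
pose T := s%:R * p; have T0 : 0 <= T by rewrite mulr_ge0; case/andP: p_bnd.
(* Chosen so that [a * x ^+ c] reaches 1 at c = (1 + g) T and [b * y ^+ c] at c = (1 - g) T. *)
pose a := expR (- (g / 2 * (1 + g) * T)); pose b := expR (g / 2 * (1 - g) * T).
pose x := expR (g / 2); pose y := expR (- (g / 2)).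
have leaf c : 1 - a * x ^+ c - b * y ^+ c <= success_prob G P (Ret (h c)).
  rewrite /= /a /x /b /y -!expRM_natl -!expRD.
  set u := expR _; set v := expR _.
  have [u0 v0] : 0 <= u /\ 0 <= v by rewrite !expR_ge0.
  have [Pc|nPc] := boolP (P (h c)); first by rewrite /=; lra.
  have far : ~~ (`|c%:R - T| <= g * T) by apply: contra nPc; apply: hP.
  rewrite ler_distlC negb_and -!ltNge in far.
  case/orP: far => far.
    suff : 1 <= u by rewrite /=; lra.
    by rewrite -expR0 ler_expR; nra.
  suff : 1 <= v by rewrite /=; lra.
  by rewrite -expR0 ler_expR; nra.
have := @success_sample_active_ge R n G D G_deg D0 P t (fun c => Ret (h c)) a b x y
  n0 (expR_ge0 _) (expR_ge0 _) (expR_ge0 _) (expR_ge0 _) leaf s 0%N.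
apply: le_trans; rewrite !expr0 !mulr1 -/p.
have up : a * mgf p x ^+ s <= expR (- (T * (g ^+ 2 / 5))).
  apply: le_trans (ler_wpM2l (expR_ge0 _) (@mgf_expR_le _ _ s p_bnd _)) _; first lra.
  rewrite -expRD ler_expR -/T.
  by have := ler_wpM2l T0 (exponent_upper g_bnd); lra.
have lo : b * mgf p y ^+ s <= expR (- (T * (g ^+ 2 / 5))).
  apply: le_trans (ler_wpM2l (expR_ge0 _) (@mgf_expR_le _ _ s p_bnd _)) _; first lra.
  rewrite -expRD ler_expR -/T.
  by have := ler_wpM2l T0 (exponent_lower g_bnd); lra.
by rewrite -/T; lra.
Qed.
End Concentration.

(** Since exp (1/2) <= 1 / (1 - 1/2) = 2 <= 1 / delta. *)
Lemma ln_inv_ge_half (R : realType) (delta : R) :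
  0 < delta <= 1 / 2 -> 1 / 2 <= ln (delta^-1).
Proof.
move=> /andP[d0 d1]; have i0 : 0 < delta^-1 by rewrite invr_gt0.
rewrite -ler_expR lnK ?posrE //.
have := @expR_le_inv1B R (1 / 2); have -> : (1 - 1 / 2 : R)^-1 = 2 by field.
move=> /(_ _)/le_trans; apply; first lra.
by rewrite -[leRHS]mul1r ler_pdivlMr //; lra.
Qed.

(** * Choice of parameters and the query budget *)

Section Budget.
Variables (R : realType) (eps L : R) (Delta : nat).
Hypothesis eps_bnd : 0 < eps <= 1.
Hypothesis L_ge : 1 / 2 <= L.
Hypothesis Delta_ge3 : (3 <= Delta)%N.

Definition rounds : nat := Num.truncn (2 * Delta%:R / eps).
(** With active density p >= 1 / (2 Delta) and relative error eps / 3, the Chernoff exponent is at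
    least 180 L / (2 * 45) = 2 L. *)
Definition samples : nat := (Num.truncn (180 * Delta%:R * eps ^- 2 * L)).+1.

Lemma rounds_gt : 2 * Delta%:R / eps < rounds.+1%:R.
Proof. exact: truncnS_gt. Qed.

Lemma rounds_le : rounds%:R <= 2 * Delta%:R / eps.
Proof.
have /andP[e0 e1] := eps_bnd.
by rewrite truncn_le divr_ge0 ?mulr_ge0 // ltW.
Qed.

Lemma samples_ge : 180 * Delta%:R * eps ^- 2 * L <= samples%:R.
Proof. exact/ltW/truncnS_gt. Qed.

Lemma samples_le : samples%:R <= 181 * Delta%:R * eps ^- 2 * L.
Proof.
have /andP[e0 e1] := eps_bnd.
have e2 : 1 <= eps ^- 2 by rewrite invf_ge1 ?exprn_gt0 // exprn_ile1 // ltW.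
have L2 := L_ge; have D3 := Delta_ge3; rewrite -(ler_nat R) in D3.
have DL : 3 * (1 / 2) <= Delta%:R * L by nra.
(* This absorbs the rounding up, turning 180 into 181. *)
have ge1 : 1 <= Delta%:R * eps ^- 2 * L.
  by nra.
have := @truncn_le R (180 * Delta%:R * eps ^- 2 * L).
have -> : 0 <= 180 * Delta%:R * eps ^- 2 * L by lra.
by move=> trunc_le; rewrite /samples -addn1 natrD; lra.
Qed.

Lemma query_budget q : (q <= samples * (2 * Delta.+1 ^ rounds))%N ->
  q%:R <= 25 * 10 ^+ 3 * eps ^- 2 * ((Delta%:R - 1) `^ (3 + 4 * Delta%:R / eps)) * L.
Proof.
move=> le_q; have /andP[e0 e1] := eps_bnd.
have L2 := L_ge; have D3 := Delta_ge3; rewrite -(ler_nat R) in D3.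
set B : R := Delta%:R - 1.
have B2 : 2 <= B by rewrite /B; lra.
(* This changes the base from Delta + 1 to Delta - 1 at the price of doubling the exponent; the
   extra [B ^+ 3] pays for the factor Delta in [samples]. *)
have DB : Delta%:R + 1 <= B ^+ 2 by rewrite /B; nra.
have pow_ge : B ^+ 3 * (Delta%:R + 1) ^+ rounds <= B `^ (3 + 4 * Delta%:R / eps).
  apply: (@le_trans _ _ (B ^+ (3 + 2 * rounds))).
    rewrite exprD exprM ler_wpM2l //; first by rewrite exprn_ge0 //; lra.
    by apply: lerXn2r => //; rewrite nnegrE; nra.
  rewrite -powR_mulrn; last lra.
  apply: ler_powR; first lra.
  by rewrite natrD lerD2l natrM; have := rounds_le; lra.
apply: (@le_trans _ _ (samples * (2 * Delta.+1 ^ rounds))%:R).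
  by rewrite ler_nat.
rewrite !natrM natrX -[Delta.+1]addn1 natrD.
set X := (Delta%:R + 1) ^+ rounds in pow_ge *.
set Y := _ `^ _ in pow_ge *.
have X0 : 0 <= X by rewrite exprn_ge0 //; lra.
have DX : Delta%:R * X <= Y.
  apply: le_trans pow_ge; rewrite ler_wpM2r //.
  by rewrite exprS; nra.
have eL : 0 <= eps ^- 2 * L.
  by apply: mulr_ge0; [rewrite invr_ge0 exprn_ge0 // ltW | lra].
have := ler_wpM2r (_ : 0 <= 2 * X) samples_le.
move=> /(_ _)/le_trans; apply; first lra.
have -> : 181 * Delta%:R * eps ^- 2 * L * (2 * X)
    = 362 * (eps ^- 2 * L * (Delta%:R * X)) by ring.
set E := eps ^- 2 * L * Y.
(* 25 * 10 ^+ 3 is kept as a product: the literal would be a unary numeral. *)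
have -> : 25 * 10 ^+ 3 * eps ^- 2 * Y * L = 25 * (10 ^+ 3 * E) by rewrite /E; ring.
have E0 : 0 <= E by rewrite mulr_ge0 // powR_ge0.
have hundredE : 100 * E <= 10 ^+ 3 * E.
  by rewrite ler_wpM2r // !exprS expr0; lra.
have := ler_wpM2l eL DX; rewrite -/E; lra.
Qed.
End Budget.

(** Truncation costs a factor of at most 1 + eps / 2 and sampling 1 + eps / 3; their product is at
    most 1 + eps because eps <= 1. From below only the sampling error counts, as m <= a. *)
Lemma estimate_error (R : realType) (eps : R) (Delta k m a : nat) (x : R) :
  0 < eps <= 1 -> 2 * Delta%:R / eps < k%:R -> (0 < Delta)%N ->
  (m <= a)%N -> (k * (a - m) <= Delta * m)%N ->
  `|x - a%:R| <= eps / 3 * a%:R -> `|x - m%:R| <= eps * m%:R.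
Proof.
move=> /andP[e0 e1]; rewrite ltr_pdivrMr // => k_big D0 le_ma.
rewrite -(ler_nat R) !natrM natrB // => le_kam.
have le_R : m%:R <= a%:R :> R by rewrite ler_nat.
have D0R : 0 < Delta%:R :> R by rewrite ltr0n.
have a_le : a%:R - m%:R <= eps / 2 * m%:R.
  rewrite -(ler_pM2l D0R); have : 0 <= (a%:R - m%:R) * (k%:R * eps - 2 * Delta%:R).
    by apply: mulr_ge0; [rewrite subr_ge0 | rewrite subr_ge0 ltW].
  by have := ler_wpM2r (ltW e0) le_kam; lra.
have m0 : 0 <= m%:R :> R by [].
rewrite !ler_distl => /andP[lo hi].
have em : eps * (eps * m%:R) <= eps * m%:R.
  by rewrite ler_pM2l // ler_piMl.
have ea := ler_wpM2l (ltW e0) a_le.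
have ea' : 0 <= eps * (a%:R - m%:R) by rewrite mulr_ge0 ?subr_ge0 // ltW.
by apply/andP; split; lra.
Qed.

Theorem theorem3 (R : realType) (delta eps : R) (Delta : nat) :
  0 < delta <= 1 / 2 -> 0 < eps <= 1 -> (3 <= Delta)%N ->
  exists A : nat -> forall V : eqType, alg R V,
    forall (n : nat) (G : bigraph n),
      bicoloured G -> no_isolated G -> max_degree_le G Delta ->
      (num_queries G (A n 'I_n))%:R
        <= 25 * 10 ^+ 3 * eps ^- 2 * ((Delta%:R - 1) `^ (3 + 4 * Delta%:R / eps))
           * ln (delta^-1)
      /\ exists M : {set {set 'I_n}},
           stable_matching G M /\
           1 - delta <= success_prob G
                          (fun m => `|m - (#|M|)%:R| <= eps * (#|M|)%:R)
                          (A n 'I_n).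
Proof.
move=> delta_bnd eps_bnd Delta_ge3.
have /andP[d0 d1] := delta_bnd; have /andP[e0 e1] := eps_bnd.
have Delta0 : (0 < Delta)%N by apply: leq_trans Delta_ge3.
set L := ln _; have L2 : 1 / 2 <= L := ln_inv_ge_half delta_bnd.
pose k := rounds eps Delta; pose s := samples eps L Delta.
(* The empty graph is treated apart: a [Sample] node there has success probability 0. *)
exists (fun n V => if n is 0 then Ret 0 else
  sample_active k s 0 (fun c => Ret (n%:R * (c%:R / s%:R)))).
move=> n G G_bic G_noiso G_deg.
split.
  apply: query_budget => //; case: n G {G_bic G_noiso} G_deg => [|n] G G_deg //.
  by rewrite -[leqRHS]addn0; apply: (num_queries_sample_active G_deg).
have [M [M_stable le_MA le_k le_n]] := truncated_gale_shapley G_bic G_deg k G_noiso.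
exists M; split=> //.
case: n G G_bic G_noiso G_deg M M_stable le_MA le_k le_n => [|n] G G_bic G_noiso
  G_deg M M_stable le_MA le_k le_n.
  have -> : #|M| = 0%N.
    by apply/eqP; rewrite -leqn0 (leq_trans le_MA) // (leq_trans (max_card _)) ?card_ord.
  by rewrite /= subrr normr0 mulr0 lexx /=; lra.
have n0 : (0 < n.+1)%N by [].
set a := #|active G k| in le_MA le_k; set p : R := a%:R / n.+1%:R.
have n1 : 0 < n.+1%:R :> R by rewrite ltr0n.
have s1 : 0 < s%:R :> R by rewrite ltr0n.
have [n_neq0 s_neq0] := (lt0r_neq0 n1, lt0r_neq0 s1).
have g_bnd : 0 < eps / 3 <= 1 / 3 by lra.
apply: le_trans (success_estimate G_deg Delta0 n0 g_bnd _); last first.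
  move=> c; rewrite -/a -/p => c_near.
  apply: (estimate_error (a := a) eps_bnd (rounds_gt eps Delta)) => //.
  have -> : n.+1%:R * (c%:R / s%:R) - a%:R
      = n.+1%:R / s%:R * (c%:R - s%:R * p).
    rewrite /p; move: n_neq0 s_neq0; move: n.+1%:R s%:R => N S N0 S0.
    by field; rewrite N0 S0.
  rewrite normrM [`|_ / _|]ger0_norm ?divr_ge0 //.
  have -> : eps / 3 * a%:R = n.+1%:R / s%:R * (eps / 3 * (s%:R * p)).
    rewrite /p; move: n_neq0 s_neq0; move: n.+1%:R s%:R => N S N0 S0.
    by field; rewrite N0 S0.
  by rewrite ler_pM2l // divr_gt0.
rewrite -/a -/p lerD2l lerN2.
have p_ge : 1 <= 2 * Delta%:R * p.
  rewrite /p mulrA ler_pdivlMr // mul1r -!natrM ler_nat.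
  by rewrite (leq_trans le_n) // leq_mul2l le_MA orbT.
have exp_ge : 2 * L <= s%:R * p * ((eps / 3) ^+ 2 / 5).
  have p0 : 0 <= p by rewrite /p divr_ge0 // ltW.
  have := ler_wpM2r p0 (samples_ge eps L Delta); rewrite -/s => le_sp.
  have eE : eps ^- 2 * eps ^+ 2 = 1 by rewrite mulVf // expf_neq0 // gt_eqF.
  have e2 : 0 <= eps ^+ 2 / 45 by rewrite divr_ge0 ?exprn_ge0 // ltW.
  have := ler_wpM2r e2 le_sp.
  have -> : 180 * Delta%:R * eps ^- 2 * L * p * (eps ^+ 2 / 45)
    = (eps ^- 2 * eps ^+ 2) * (2 * L * (2 * Delta%:R * p)).
    by field; rewrite gt_eqF.
  have -> : (eps / 3) ^+ 2 / 5 = eps ^+ 2 / 45 by field.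
  rewrite eE mul1r; apply: le_trans.
  by rewrite ler_peMr //; lra.
(* The failure probability is at most 2 delta^2, which is at most delta since delta <= 1/2. *)
apply: (@le_trans _ _ (2 * expR (- (2 * L)))).
  by rewrite ler_pM2l // ler_expR lerN2.
have -> : - (2 * L) = - L + - L by ring.
have expNL : expR (- L) = delta by rewrite expRN lnK ?posrE ?invr_gt0 // invrK.
by rewrite expRD expNL; nra.
Qed.
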